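(* Let $p\ge 1$ be a real number. Let $H$ be a finitely generated amenable group whose $\ell^p$-isoperimetric profile $j_{p,H}$ satisfies Assumption $(\star)$. Assume moreover that $$j_{p,H}\left(\frac{x}{\ln(x)}\right)\simeq j_{p,H}(x)\quad\text{and}\quad j_{p,H}(x)\simeq j_{1,H}(x).$$ Then $$j_{p,\mathsf{Shuffler}(H)}(x)\simeq j_{p,H}(\ln(x)).$$
   Context: Isoperimetric profile: for a finitely generated group $G$ with finite generating set $S_G$ and a real $p\ge 1$, $j_{p,G}(x)=\sup \|f\|_p/\|\nabla f\|_p$, the supremum being over (nonzero) functions $f\colon G\to\mathbb{R}_+$ with $|\mathrm{supp}\, f|\le x$, where $\mathrm{supp}\, f=\{g: f(g)\neq 0\}$ and $\|\nabla f\|_p^p=\sum_{g\in G,\,s\in S_G}|f(g)-f(gs)|^p$. Up to the relation $\simeq$ below it does not depend on $S_G$. Asymptotic comparison: for non-decreasing functions, $f\preccurlyeq g$ means that there is $C>0$ such that $f(x)=O(g(Cx))$ as $x\to+\infty$; $f\simeq g$ means $f\preccurlyeq g$ and $g\preccurlyeq f$. Expressions are considered for $x$ large enough. Assumption $(\star)$: a non-decreasing function $h$ satisfies Assumption $(\star)$ if for every $C>0$, $h(Cx)=O(h(x))$ as $x\to+\infty$. Lampshuffler: $\mathsf{Shuffler}(H)=\mathsf{FSym}(H)\rtimes H$, where $\mathsf{FSym}(H)$ is the group of finitely supported bijections $H\to H$ and $H$ acts by $(h\cdot\sigma)(x)=h\sigma(h^{-1}x)$. It is finitely generated when $H$ is.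 *)

(* Defs.v *)
From HB Require Import structures.
From mathcomp Require Import all_boot all_order all_algebra.
From mathcomp Require Import finmap all_classical all_reals all_analysis.
Set Implicit Arguments.
Unset Strict Implicit.
Unset Printing Implicit Defensive.
Import Order.TTheory GRing.Theory Num.Theory.
Import numFieldNormedType.Exports.
Local Open Scope classical_set_scope.
Local Open Scope ring_scope.

(* Infinite groups are MathComp's [groupType], written multiplicatively in
   [group_scope]; no symmetry of generating sets is required. *)

Definition is_subgroup (G : groupType) (K : set G) : Prop :=
  K 1%g /\ (forall x y, K x -> K y -> K (x * y^-1)%g).

Definition generates (G : groupType) (S : {fset G}) : Prop :=
  forall K : set G, is_subgroup K -> [set` S] `<=` K -> K = setT.

(* Existence of a left-invariant finitely additive probability measure defined
   on all subsets of G. *)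
Definition amenable (R : realType) (G : groupType) : Prop :=
  exists m : set G -> R,
    [/\ forall A, 0 <= m A,
        m setT = 1,
        forall A B, A `&` B = set0 -> m (A `|` B) = m A + m B
      & forall g A, m [set (g * x)%g | x in A] = m A].

Section Profile.
Context {R : realType} {G : groupType}.
Implicit Types (p x : R) (S : {fset G}) (f : G -> R).

Definition supp f : set G := [set g | f g != 0].

(* The sums over G are finite for finitely supported f, the only functions to
   which [lp_norm] and [lp_grad] are applied below. *)
Definition lp_norm p f : R :=
  (\sum_(g \in [set: G]) `|f g| `^ p) `^ p^-1.

Definition lp_grad p S f : R :=
  (\sum_(g \in [set: G]) \sum_(s <- S) `|f g - f (g * s)%g| `^ p) `^ p^-1.

Definition admissible x f : Prop :=
  [/\ forall g, 0 <= f g,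
      exists g, f g != 0,
      finite_set (supp f)
    & #|` fset_set (supp f)|%:R <= x].

(* The supremum is taken in the extended reals, where a / 0 = +oo for a > 0;
   if S generates G, this only happens when G is finite and f is constant. *)
Definition profile p S x : \bar R :=
  ereal_sup [set ((lp_norm p f)%:E / (lp_grad p S f)%:E)%E
            | f in admissible x].

End Profile.

Section Asymptotics.
Context {R : realType}.
Implicit Types f g h : R -> \bar R.

(* f(x) = O(g(x)) as x -> +oo; the Landau notations of the library require
   values in a normed module, which \bar R is not. *)
Definition bigOe f g : Prop :=
  exists2 K : R, 0 < K &
    \forall x \near +oo%R, (`|f x| <= K%:E * `|g x|)%E.

Definition asymp_le f g : Prop :=
  exists2 C : R, 0 < C & bigOe f (fun x => g (C * x)).

Definition asymp_eq f g : Prop := asymp_le f g /\ asymp_le g f.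

Definition assumption_star h : Prop :=
  forall C : R, 0 < C -> bigOe (fun x => h (C * x)) h.

End Asymptotics.

Section FinPerm.
Variable T : Type.

Record finperm := FinPerm {
  finperm_fun :> T -> T;
  finperm_bij : bijective finperm_fun;
  finperm_fin : finite_set [set x | finperm_fun x <> x] }.

Lemma finpermP (s t : finperm) : (forall x, s x = t x) -> s = t.
Proof.
case: s t => [s sb sf] [t tb tf] /= /funext st.
move: sb sf tb tf; rewrite st => sb sf tb tf.
by congr FinPerm; apply: Prop_irrelevance.
Qed.

HB.instance Definition _ := gen_eqMixin finperm.
HB.instance Definition _ := gen_choiceMixin finperm.

Fact finperm1_fin : finite_set [set x : T | id x <> x].
Proof. by rewrite (_ : mkset _ = set0) // -subset0 => x /(_ erefl). Qed.
Definition finperm1 : finperm :=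
  FinPerm (Bijective (frefl id) (frefl id)) finperm1_fin.

Fact finpermM_fin (s t : finperm) : finite_set [set x | (s \o t) x <> x].
Proof.
apply: (@sub_finite_set _ _ ([set x | t x <> x] `|` [set x | s x <> x])).
  move=> x /= stx; case: (pselect (t x = x)) => [tx|]; last by left.
  by right; rewrite -{1}tx.
by rewrite finite_setU; split; apply: finperm_fin.
Qed.
Definition finpermM (s t : finperm) : finperm :=
  FinPerm (bij_comp (finperm_bij s) (finperm_bij t)) (finpermM_fin s t).

Fact finpermV_ex (s : finperm) : exists t : finperm, cancel s t /\ cancel t s.
Proof.
case: (finperm_bij s) => r sr rs.
have rfin : finite_set [set x | r x <> x].
  apply: sub_finite_set (finperm_fin s) => x /= rx sx; apply: rx.
  by rewrite -{1}sx sr.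
by exists (FinPerm (Bijective rs sr) rfin).
Qed.
Definition finpermV (s : finperm) : finperm := projT1 (cid (finpermV_ex s)).

Lemma finpermK (s : finperm) : cancel s (finpermV s).
Proof. by rewrite /finpermV; case: cid => t []. Qed.
Lemma finpermVK (s : finperm) : cancel (finpermV s) s.
Proof. by rewrite /finpermV; case: cid => t []. Qed.

Fact finpermA : associative finpermM.
Proof. by move=> s t u; apply: finpermP. Qed.
Fact finperm1M : left_id finperm1 finpermM.
Proof. by move=> s; apply: finpermP. Qed.
Fact finpermM1 : right_id finperm1 finpermM.
Proof. by move=> s; apply: finpermP. Qed.
Fact finpermVM : left_inverse finperm1 finpermV finpermM.
Proof. by move=> s; apply: finpermP => x /=; rewrite finpermK. Qed.
Fact finpermMV : right_inverse finperm1 finpermV finpermM.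
Proof. by move=> s; apply: finpermP => x /=; rewrite finpermVK. Qed.

HB.instance Definition _ :=
  isGroup.Build finperm finpermA finperm1M finpermM1 finpermVM finpermMV.

End FinPerm.

Section Shuffler.
Variable H : groupType.
Implicit Types (h k : H) (s t : finperm H).

Definition translate h s : H -> H := fun x => (h * s (h^-1 * x))%g.

Fact translate_bij h s : bijective (translate h s).
Proof.
exists (translate h (s^-1)%g) => x; rewrite /translate mulKg.
  by rewrite [X in (_ * X)%g]finpermK mulgA mulgV mul1g.
by rewrite finpermVK mulgA mulgV mul1g.
Qed.

Fact translate_fin h s : finite_set [set x | translate h s x <> x].
Proof.
apply: (@sub_finite_set _ _ [set (h * x)%g | x in [set x | s x <> x]]).
  move=> x /= hx; exists (h^-1 * x)%g; last by rewrite mulgA mulgV mul1g.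
  by move=> e; apply: hx; rewrite /translate e mulgA mulgV mul1g.
by apply: finite_image; apply: finperm_fin.
Qed.

Definition finperm_act h s : finperm H :=
  FinPerm (translate_bij h s) (translate_fin h s).

Lemma finperm_act1g s : finperm_act 1%g s = s.
Proof. by apply: finpermP => x; rewrite /= /translate invg1 !mul1g. Qed.
Lemma finperm_actM h k s :
  finperm_act (h * k)%g s = finperm_act h (finperm_act k s).
Proof. by apply: finpermP => x; rewrite /= /translate invgM !mulgA. Qed.
Lemma finperm_act1 h : finperm_act h 1%g = 1%g.
Proof. by apply: finpermP => x; rewrite /= /translate mulgA mulgV mul1g. Qed.
Lemma finperm_act_morph h s t :
  finperm_act h (s * t)%g = (finperm_act h s * finperm_act h t)%g.
Proof. by apply: finpermP => x; rewrite /= /translate mulKg. Qed.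

Record shuffler := Shuffle { sh_perm : finperm H; sh_pos : H }.

HB.instance Definition _ := gen_eqMixin shuffler.
HB.instance Definition _ := gen_choiceMixin shuffler.

Definition sh1 : shuffler := Shuffle 1%g 1%g.
Definition shM (a b : shuffler) : shuffler :=
  Shuffle (sh_perm a * finperm_act (sh_pos a) (sh_perm b))%g
          (sh_pos a * sh_pos b)%g.
Definition shV (a : shuffler) : shuffler :=
  Shuffle (finperm_act (sh_pos a)^-1 (sh_perm a)^-1)%g (sh_pos a)^-1%g.

Fact shA : associative shM.
Proof.
by move=> a b c; rewrite /shM /= finperm_act_morph finperm_actM !mulgA.
Qed.
Fact sh1M : left_id sh1 shM.
Proof. by case=> s h; rewrite /shM /= finperm_act1g !mul1g. Qed.
Fact shM1 : right_id sh1 shM.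
Proof. by case=> s h; rewrite /shM /= finperm_act1 !mulg1. Qed.
Fact shVM : left_inverse sh1 shV shM.
Proof.
by case=> s h; rewrite /shM /shV /= -finperm_act_morph !mulVg finperm_act1.
Qed.
Fact shMV : right_inverse sh1 shV shM.
Proof.
by case=> s h; rewrite /shM /shV /= -finperm_actM !mulgV finperm_act1g mulgV.
Qed.

HB.instance Definition _ := isGroup.Build shuffler shA sh1M shM1 shVM shMV.

End Shuffler.

(* Main.v *)
(* Upper bound.  Passing from f to f ^ p reduces the problem to p = 1, and the
   coarea formula then to finite sets B of pairs (s, h).  Fix s0 <> 1 and let t
   be the element swapping 1 and s0, so that (s, h) t = (s (h  h s0), h).  If B
   has boundary at most e #|B|, deleting bad fibres over the permutations s
   yields a set all of whose fibres have relative boundary O(e) in H, hence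
   more than y points when e is small compared with 1 / j_{1,H}(y), and in
   which at least a quarter of each fibre stays in the set under t.  Every
   permutation s that occurs is thus joined to s (h  h s0) for at least y / 4
   values of h, and a set of permutations with that property has exponential
   size in y: split it by the value at a point.  Hence
   j_{1,Shuffler(H)}(x) is bounded by a multiple of j_{1,H}(c ln x).

   Lower bound.  The functions (s, h) |-> f h, restricted to permutations s
   supported in a bounded neighbourhood V of supp f, have the same energy to
   mass ratio as f up to constants, and support of size exp(O(n ln n)) where
   n = #|supp f|.  This gives j_{p,H}(c ln x / ln ln x), which the hypothesis
   on j_{p,H}(x / ln x) turns into j_{p,H}(ln x). *)
Require Import Defs.
From mathcomp Require Import all_boot all_order all_algebra.
From mathcomp Require Import finmap all_classical all_reals all_analysis.
From mathcomp Require Import zify lra ring.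
Set Implicit Arguments.
Unset Strict Implicit.
Unset Printing Implicit Defensive.
Import Order.TTheory GRing.Theory Num.Theory.
Import numFieldNormedType.Exports.
Local Open Scope classical_set_scope.
Local Open Scope ring_scope.

(** * Sums, mass and energy of finitely supported functions *)

Section FiniteSupport.
Context {R : realType} {G : groupType}.
Implicit Types (F K f : G -> R) (p : R).

(** A sum over [[set: G]] is 0 by default when its support is infinite; this is why additivity and
    comparison below ask for finite supports. *)
Lemma fsum_supp F (D : set G) : finite_set D -> supp F `<=` D ->
  \sum_(g \in [set: G]) F g = \sum_(g <- fset_set D) F g.
Proof.
move=> Dfin FD; apply: fsbigTE => g; rewrite in_fset_set// => gD.
apply/eqP; apply: contraNT gD => Fg; rewrite inE; exact: FD.
Qed.

Lemma supp_op2 (op : R -> R -> R) F K : op 0 0 = 0 ->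
  finite_set (supp F) -> finite_set (supp K) ->
  finite_set (supp (fun g => op (F g) (K g))).
Proof.
move=> op0 finF finK; have := conj finF finK.
rewrite -finite_setU; apply: sub_finite_set => g /=.
rewrite /supp /=; case: (eqVneq (F g) 0) => [->|]; last by left.
by case: (eqVneq (K g) 0) => [->|]; [rewrite op0 eqxx|right].
Qed.

Lemma supp_translate F (a : G) :
  finite_set (supp F) -> finite_set (supp (fun g => F (g * a)%g)).
Proof.
move=> finF; have -> : supp (fun g => F (g * a)%g) = (fun g => g * a)%g @^-1` supp F by [].
by apply: finite_preimage => // x y _ _; apply: mulIg.
Qed.

Lemma supp_sum (I : Type) (l : seq I) (F : I -> G -> R) :
  (forall i, finite_set (supp (F i))) ->
  finite_set (supp (fun g => \sum_(i <- l) F i g)).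
Proof.
move=> finF; elim: l => [|i l IH].
  rewrite (_ : supp _ = set0) // -subset0 => g /=.
  by rewrite /supp /= big_nil eqxx.
rewrite (_ : supp _ = supp (fun g => F i g + \sum_(j <- l) F j g)).
  by apply: supp_op2; rewrite ?addr0.
by apply/funext => g; rewrite /supp /= big_cons.
Qed.

Lemma supp_dpow p F (a : G) : 0 < p -> finite_set (supp F) ->
  finite_set (supp (fun g => `|F g - F (g * a)%g| `^ p)).
Proof.
move=> p0 finF; apply: (supp_op2 (op := fun u v => `|u - v| `^ p)) => //.
- by rewrite subrr normr0 powR0// gt_eqF.
- exact: supp_translate.
Qed.

Lemma supp_pow p F : 0 < p -> finite_set (supp F) ->
  finite_set (supp (fun g => `|F g| `^ p)).
Proof.
move=> p0 finF; apply: (supp_op2 (op := fun u _ => `|u| `^ p) _ finF finF).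
by rewrite normr0 powR0// gt_eqF.
Qed.

Lemma fsumD F K : finite_set (supp F) -> finite_set (supp K) ->
  \sum_(g \in [set: G]) (F g + K g) =
  \sum_(g \in [set: G]) F g + \sum_(g \in [set: G]) K g.
Proof.
move=> finF finK; have finU : finite_set (supp F `|` supp K) by rewrite finite_setU.
rewrite !(fsum_supp finU) ?big_split//.
move=> g /=; rewrite /supp /=; case: (eqVneq (F g) 0) => [->|]; last by left.
by case: (eqVneq (K g) 0) => [->|]; [rewrite addr0 eqxx|right].
Qed.

Lemma fsum_translate F (a : G) :
  \sum_(g \in [set: G]) F (g * a)%g = \sum_(g \in [set: G]) F g.
Proof.
apply: esym; apply: (@reindex_fsbigT _ _ _ _ _ (fun g => g * a)%g F).
by exists (fun g => g * a^-1)%g => g; rewrite -mulgA ?mulgV ?mulVg mulg1.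
Qed.

Lemma ler_fsum F K : finite_set (supp F) -> finite_set (supp K) ->
  (forall g, F g <= K g) ->
  \sum_(g \in [set: G]) F g <= \sum_(g \in [set: G]) K g.
Proof.
move=> finF finK FK; have finU : finite_set (supp F `|` supp K) by rewrite finite_setU.
rewrite !(fsum_supp finU).
- by apply: ler_sum.
- by move=> g; right.
- by move=> g; left.
Qed.

Lemma fsum_sum (I : Type) (l : seq I) (F : I -> G -> R) :
  (forall i, finite_set (supp (F i))) ->
  \sum_(g \in [set: G]) \sum_(i <- l) F i g =
  \sum_(i <- l) \sum_(g \in [set: G]) F i g.
Proof.
move=> finF; elim: l => [|i l IH].
  by rewrite big_nil; apply: fsbig1 => g _; rewrite big_nil.
rewrite big_cons -IH -fsumD//; last exact: supp_sum.
by apply: eq_fsbigr => g _; rewrite big_cons.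
Qed.

Definition mass p f : R := \sum_(g \in [set: G]) `|f g| `^ p.

(** The steps form a list, so that single steps and images of generating sets with repetitions are
    covered as well. *)
Definition energy p (l : seq G) f : R :=
  \sum_(g \in [set: G]) \sum_(s <- l) `|f g - f (g * s)%g| `^ p.

Lemma mass_ge0 p f : 0 <= mass p f.
Proof. by apply: fsumr_ge0 => g _; apply: powR_ge0. Qed.

Lemma energy_ge0 p l f : 0 <= energy p l f.
Proof. by apply: fsumr_ge0 => g _; apply: sumr_ge0 => s _; apply: powR_ge0. Qed.

Lemma energyE p l f : 0 < p -> finite_set (supp f) ->
  energy p l f = \sum_(s <- l) energy p [:: s] f.
Proof.
move=> p0 finf; rewrite /energy fsum_sum; last by move=> s; apply: supp_dpow.
by apply: eq_bigr => s _; apply: eq_fsbigr => g _; rewrite big_seq1.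
Qed.

Lemma energy1E p s f : energy p [:: s] f = \sum_(g \in [set: G]) `|f g - f (g * s)%g| `^ p.
Proof. by apply: eq_fsbigr => g _; rewrite big_seq1. Qed.

Lemma powR_normD p (a b : R) : 0 < p ->
  `|a + b| `^ p <= 2 `^ p * (`|a| `^ p + `|b| `^ p).
Proof.
move=> p0.
wlog ab : a b / `|a| <= `|b|.
  by move=> H; case: (leP `|a| `|b|) => [|/ltW] /H//;
    rewrite addrC [X in _ <= _ * X]addrC.
apply: (@le_trans _ _ ((2 * `|b|) `^ p)).
  apply: ge0_ler_powR; rewrite ?nnegrE ?(ltW p0) ?mulr_ge0//.
  by apply: (le_trans (ler_normD _ _)); rewrite mulr_natl mulr2n lerD2r.
rewrite powRM//; apply: ler_wpM2l; first exact: powR_ge0.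
by rewrite lerDr powR_ge0.
Qed.

(* The elements whose difference operator is controlled form a subgroup. *)
Lemma energy_word p (T : {fset G}) (a : G) : 0 < p -> generates T ->
  exists2 C, 0 <= C &
    forall f, finite_set (supp f) -> energy p [:: a] f <= C * energy p T f.
Proof.
move=> p0 genT.
pose K : set G := [set a | exists2 C, 0 <= C &
    forall f, finite_set (supp f) -> energy p [:: a] f <= C * energy p T f].
suff KT : K = setT by have : K a by rewrite KT.
apply: genT; first split.
- exists 0 => // f _; rewrite mul0r energy1E fsbig1// => g _.
  by rewrite mulg1 subrr normr0 powR0// gt_eqF.
- move=> x y [C C0 CP] [D D0 DP]; exists (2 `^ p * (C + D)).
    by rewrite mulr_ge0 ?powR_ge0 ?addr_ge0.
  move=> f finf; rewrite -mulrA mulrDl.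
  apply: (@le_trans _ _ (2 `^ p * (energy p [:: x] f + energy p [:: y] f))); last first.
    by apply: ler_wpM2l; [exact: powR_ge0|rewrite lerD ?CP ?DP].
  (* Substituting g x y^-1 for g turns the y-difference into the second half of the path from g
     through g x to g x y^-1. *)
  have -> : energy p [:: y] f =
      \sum_(g \in [set: G]) `|f (g * (x * y^-1))%g - f (g * (x * y^-1) * y)%g| `^ p.
    by rewrite energy1E; apply/esym/(fsum_translate (fun g => `|f g - f (g * y)%g| `^ p)).
  rewrite !energy1E.
  rewrite -fsumD; [|exact: supp_dpow|]; last first.
    by apply: (@supp_translate (fun g => `|f g - f (g * y)%g| `^ p)); apply: supp_dpow.
  rewrite mulr_fsumr; apply: ler_fsum; first exact: supp_dpow.
    apply: (supp_op2 (op := fun u v => 2 `^ p * (u + v))); rewrite ?addr0 ?mulr0//.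
      exact: supp_dpow.
    by apply: (@supp_translate (fun g => `|f g - f (g * y)%g| `^ p)); apply: supp_dpow.
  move=> g; rewrite -(mulgA g) mulgVK.
  have -> : f g - f (g * (x * y^-1))%g =
      (f g - f (g * x)%g) + - (f (g * (x * y^-1))%g - f (g * x)%g) by ring.
  by apply: (le_trans (powR_normD _ _ p0)); rewrite normrN.
- move=> s /= sT; exists 1 => // f finf; rewrite mul1r [X in _ <= X]energyE//.
  rewrite (big_fsetD1 s)//= lerDl.
  by apply: sumr_ge0 => t _; apply: energy_ge0.
Qed.

Lemma energy_words p (T : {fset G}) (l : seq G) : 0 < p -> generates T ->
  exists2 C, 0 <= C &
    forall f, finite_set (supp f) -> energy p l f <= C * energy p T f.
Proof.
move=> p0 genT; elim: l => [|s l [C C0 CP]].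
  exists 0 => // f finf; rewrite mul0r /energy fsbig1// => g _.
  by rewrite big_nil.
have [D D0 DP] := energy_word s p0 genT.
exists (D + C) => [|f finf]; first exact: addr_ge0.
rewrite energyE// big_cons -energyE// mulrDl.
by rewrite lerD ?CP ?DP.
Qed.

End FiniteSupport.

(** * Coarea formula and pruning of fibres *)

Lemma sum_if_fset (R : comNzRingType) (I : choiceType) (A : {fset I}) (P : pred I) (c : R) :
  \sum_(a <- A) (if P a then c else 0) = c * #|` [fset a in A | P a]%fset|%:R.
Proof.
rewrite -big_mkcond -big_filter -sum1_size natr_sum mulr_sumr mulr1.
apply: perm_big; apply: uniq_perm; rewrite ?filter_uniq ?fset_uniq// => a.
by rewrite mem_filter !inE andbC.
Qed.

Section Coarea.
Context {R : realType} {G : groupType}.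
Implicit Types (A B D : {fset G}) (F : G -> R) (l : seq G).

Definition outdeg l A (g : G) : nat := count (fun s => (g * s)%g \notin A) l.

Definition boundary l A : nat := (\sum_(g <- A) outdeg l A g)%N.

Lemma fset_argmin D F : D != fset0 ->
  exists2 g0, g0 \in D & forall g, g \in D -> F g0 <= F g.
Proof.
case/fset0Pn => d dD.
case: (@Order.TotalTheory.arg_minP _ _ D [` dD]%fset xpredT (fun g => F (val g))) => // g0 _ g0min.
exists (val g0) => [|g gD]; first exact: valP.
exact: (g0min [` gD]%fset).
Qed.

(* Linear form of the coarea formula: peel off the lowest level of F. *)
Lemma coarea l (c : R) D F : 0 <= c -> (forall g, 0 <= F g) ->
  (forall g, g \notin D -> F g = 0) ->
  (forall A, A != fset0 -> (A `<=` D)%fset ->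
     #|` A|%:R <= c * (boundary l A)%:R) ->
  \sum_(g <- D) F g <=
  c * \sum_(g <- D) \sum_(s <- l) Num.max (F g - F (g * s)%g) 0.
Proof.
move=> c0; move: {2}#|` D| (leqnn #|` D|) => n.
elim: n D F => [|n IH] D F Dn F0 FD isoD.
  have -> : D = fset0 by apply/eqP; rewrite -cardfs_eq0 -leqn0.
  by rewrite !big_seq_fset0 mulr0.
case: (eqVneq D fset0) => [->|D0]; first by rewrite !big_seq_fset0 mulr0.
have [g0 g0D g0min] := fset_argmin F D0.
(* F' lowers F on D by its minimum m; it vanishes at g0, so the induction applies to D without
   g0. *)
pose m := F g0; pose F' g := F g - (if g \in D then m else 0).
have F'0 g : 0 <= F' g.
  rewrite /F'; case: ifP => [gD|_]; first by rewrite subr_ge0 g0min.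
  by rewrite subr0.
have F'g0 : F' g0 = 0 by rewrite /F' g0D subrr.
have IH' := IH (D `\ g0)%fset F'.
have {}IH' : \sum_(g <- D) F' g <=
    c * \sum_(g <- D) \sum_(s <- l) Num.max (F' g - F' (g * s)%g) 0.
  rewrite !(big_fsetD1 g0 g0D)/= F'g0 add0r.
  rewrite [X in c * (X + _)]big1 ?add0r.
    apply: IH' => //.
    - by move: Dn; rewrite (cardfsD1 g0 D) g0D.
    - move=> g; rewrite !inE negb_and negbK => /orP[/eqP->//|gD].
      by rewrite /F' (negbTE gD) subr0 FD.
    - move=> A A0 AD; apply: isoD => //.
      exact: (fsubset_trans AD (fsubD1set _ _)).
  by move=> s _; rewrite sub0r max_r// oppr_le0.
have -> : \sum_(g <- D) F g = m * #|` D|%:R + \sum_(g <- D) F' g.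
  rewrite -sum1_size natr_sum mulr_sumr -big_split/=.
  apply: eq_big_seq => g gD; rewrite /F' gD; ring.
(* Inside D the differences are unchanged; each edge leaving D contributes an extra m. *)
have -> : \sum_(g <- D) \sum_(s <- l) Num.max (F g - F (g * s)%g) 0 =
    m * (boundary l D)%:R + \sum_(g <- D) \sum_(s <- l) Num.max (F' g - F' (g * s)%g) 0.
  rewrite /boundary natr_sum mulr_sumr -big_split/=; apply: eq_big_seq => g gD.
  rewrite /outdeg -sum1_count natr_sum mulr_sumr [X in _ = X + _]big_mkcond -big_split/=.
  apply: eq_bigr => s _; rewrite /F' gD; case: ifPn => gsD /=.
    by rewrite (negbTE gsD) subr0 (FD _ gsD) !subr0 !max_l ?F0//;
      [ring|rewrite subr_ge0 g0min].
  by rewrite (negPn gsD) add0r; congr Num.max; ring.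
rewrite mulrDr lerD// mulrCA ler_wpM2l//; first exact: F0.
exact: isoD.
Qed.

End Coarea.

Section Prune.
Context {R : realType} {G : groupType} {Q : eqType}.
Context (q : G -> Q) (l : seq G) (t : G)
  (ql : forall a s, s \in l -> q (a * s)%g = q a)
  (qt : forall a, q (a * t)%g != q a)
  (tt : (t * t = 1)%g).
Implicit Types (B : {fset G}) (e : R).

Definition fibre B (x : Q) : {fset G} := [fset a in B | q a == x]%fset.

Lemma outdeg_fibre B x a : q a = x -> outdeg l (fibre B x) a = outdeg l B a.
Proof.
move=> qa; apply: eq_in_count => s sl; rewrite !inE/=.
by rewrite ql// qa eqxx andbT.
Qed.

(* Summed over B, the cost is (horizontal boundary) + 2 e (t-boundary) - e #|B|.
   The weight 2 e is small enough for the fibres to inherit a boundary of order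
   e, and large enough to force a definite proportion of the moves by t to stay
   in B. *)
Definition cost e B a : R :=
  (outdeg l B a)%:R + (if (a * t)%g \in B then 0 else 2 * e) - e.

(** The charge that deleting the fibre of a would create at the other end a t of its t-edge. *)
Definition gain e B a : R := if (a * t)%g \in B then 2 * e else 0.

(** Moves in [l] preserve [q], so outgoing degrees outside the fibre do not change; only the t-edges
    entering the fibre become charged. Since t is an involution that leaves every fibre, these
    correspond to the t-edges from the fibre into B, which [gain] counts. *)
Lemma cost_fibreD e B x :
  \sum_(a <- (B `\` fibre B x)%fset) cost e (B `\` fibre B x)%fset a =
  \sum_(a <- B) cost e B a - \sum_(a <- fibre B x) (cost e B a - gain e B a).
Proof.
set F := fibre B x; set D := (B `\` F)%fset.
have FB : (F `<=` B)%fset by apply/fsubsetP => a; rewrite !inE/= => /andP[].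
have memD a : (a \in D) = (a \in B) && (q a != x).
  by rewrite /D /F !inE/=; case: (a \in B); rewrite ?andbF ?andbT.
have memF a : (a \in F) = (a \in B) && (q a == x) by rewrite /F !inE.
rewrite (big_fsetID _ (fun a => q a == x) B)/=.
have -> : [fset a in B | q a == x]%fset = F by [].
have -> : [fset a in B | ~~ (q a == x)]%fset = D.
  by apply/fsetP => a; rewrite memD !inE.
rewrite [X in _ = _ - X]sumrB.
suff -> : \sum_(a <- D) cost e D a = \sum_(a <- D) cost e B a + \sum_(a <- F) gain e B a by ring.
clearbody D F.
have -> : \sum_(a <- D) cost e D a = \sum_(a <- D) cost e B a +
    \sum_(a <- D) (if (a * t)%g \in F then 2 * e else 0).
  rewrite -big_split; apply: eq_big_seq => a; rewrite memD => /andP[aB qa] /=.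
  rewrite /cost memD memF; have -> : outdeg l D a = outdeg l B a.
    by apply: eq_in_count => s sl; rewrite memD ql// qa andbT.
  by case: (_ \in B) => /=; [case: (_ == x) => /=; ring|ring].
rewrite /gain !sum_if_fset; congr (_ + _ * _%:R).
have tI : injective (fun a : G => a * t)%g by apply: mulIg.
transitivity #|` [fset (a * t)%g | a in [fset a in D | (a * t)%g \in F]]%fset|.
  by rewrite (card_imfset _ _ tI).
congr #|` _|; apply/fsetP => a.
have memDF b : (b \in [fset a in D | (a * t)%g \in F]%fset) =
    [&& b \in B, q b != x, (b * t)%g \in B & q (b * t)%g == x].
  by rewrite -memF andbA -memD !inE.
have memFB b : (b \in [fset a in F | (a * t)%g \in B]%fset) =
    [&& b \in B, q b == x & (b * t)%g \in B].
  by rewrite andbA -memF !inE.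
apply/imfsetP/idP => [[b bD ->]|]; rewrite memFB.
  have : b \in [fset a in D | (a * t)%g \in F]%fset by [].
  rewrite memDF => /and4P[bB qb btB qbt].
  by rewrite btB qbt -mulgA tt mulg1.
move=> /and3P[aB qa atB]; exists (a * t)%g; last by rewrite -mulgA tt mulg1.
suff : (a * t)%g \in [fset a in D | (a * t)%g \in F]%fset by [].
by rewrite memDF -mulgA tt mulg1 aB qa atB -(eqP qa) qt.
Qed.

Lemma fibre_fsub B x : (fibre B x `<=` B)%fset.
Proof. by apply/fsubsetP => a; rewrite !inE => /andP[]. Qed.

(* Deleting a whole fibre only creates boundary along the moves by t; a fibre
   whose deletion lowers the total cost can be discarded. *)
Lemma prune e B : \sum_(a <- B) cost e B a < 0 ->
  exists B', [/\ B' != fset0, (B' `<=` B)%fset &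
    forall x, \sum_(a <- fibre B' x) (cost e B' a - gain e B' a) <= 0].
Proof.
move: {2}#|` B| (leqnn #|` B|) => n; elim: n B => [|n IH] B Bn B0.
  have B00 : B = fset0 by apply/eqP; rewrite -cardfs_eq0 -leqn0.
  by move: B0; rewrite B00 big_seq_fset0 ltxx.
have [good|/existsNP[x /negP]] :=
    pselect (forall x, \sum_(a <- fibre B x) (cost e B a - gain e B a) <= 0).
  exists B; split=> //; apply/eqP => B00.
  by move: B0; rewrite B00 big_seq_fset0 ltxx.
rewrite -ltNge => bad.
have F0 : fibre B x != fset0.
  by apply/eqP => F0; move: bad; rewrite F0 big_seq_fset0 ltxx.
have [||B' [B'0 B'B B'P]] := IH (B `\` fibre B x)%fset.
- rewrite cardfsDS ?fibre_fsub//; move: Bn F0; rewrite -cardfs_eq0; lia.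
- by rewrite cost_fibreD; lra.
- by exists B'; split=> //; apply: (fsubset_trans B'B (fsubsetDl _ _)).
Qed.

(** For the fibre F and its subset N of points whose move by t stays in B, the hypothesis reads
    boundary + e #|F| - 4 e #|N| <= 0. Using #|N| <= #|F| gives the first bound, dropping the
    boundary gives the second. *)
Lemma prune_fibre e B x : 0 < e ->
  \sum_(a <- fibre B x) (cost e B a - gain e B a) <= 0 ->
  (boundary l (fibre B x))%:R <= 3 * e * #|` fibre B x|%:R /\
  #|` fibre B x|%:R <= 4 * #|` [fset a in fibre B x | (a * t)%g \in B]%fset|%:R :> R.
Proof.
move=> e0; set F := fibre B x; set N := [fset a in F | _]%fset.
have NF : (N `<=` F)%fset by apply/fsubsetP => a; rewrite !inE => /andP[].
have NF' : #|` N|%:R <= #|` F|%:R :> R by rewrite ler_nat fsubset_leq_card.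
suff -> : \sum_(a <- F) (cost e B a - gain e B a) =
    (boundary l F)%:R + e * #|` F|%:R - 4 * e * #|` N|%:R.
  have b0 : 0 <= (boundary l F)%:R :> R by [].
  by move=> h; split; nra.
have NE : #|` N|%:R = \sum_(a <- F) (if (a * t)%g \in B then 1 else 0) :> R.
  by rewrite sum_if_fset mul1r.
rewrite NE mulr_sumr /boundary natr_sum -sum1_size natr_sum mulr_sumr.
rewrite -big_split/= -sumrB; apply: eq_big_seq => a.
rewrite !inE => /andP[aB /eqP qa].
by rewrite (outdeg_fibre B qa) /cost /gain; case: ifP => _; ring.
Qed.

End Prune.

(** * Isoperimetry of the lampshuffler *)

Section Swap.
Context {H : groupType} (s0 : H).

Definition swap_fun (x : H) : H :=
  if x == 1%g then s0 else if x == s0 then 1%g else x.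

Lemma swap_funK : involutive swap_fun.
Proof.
move=> x; rewrite /swap_fun; have [->|x1] := eqVneq x 1%g.
  by rewrite eqxx; case: eqP.
by have [->|xs] := eqVneq x s0; rewrite ?eqxx// (negbTE x1) (negbTE xs).
Qed.

Lemma swap_fun_fin : finite_set [set x | swap_fun x <> x].
Proof.
apply: (@sub_finite_set _ _ [set 1%g; s0]); last by rewrite finite_setU; split;
  exact: finite_set1.
move=> x /=; rewrite /swap_fun; have [->|x1] := eqVneq x 1%g; first by left.
by have [->|] := eqVneq x s0; [right|].
Qed.

Definition swap : finperm H := FinPerm (inv_bij swap_funK) swap_fun_fin.

Lemma act_swapE h x : finperm_act h swap x =
  if x == h then (h * s0)%g else if x == (h * s0)%g then h else x.
Proof.
rewrite /= /translate /= /swap_fun.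
have -> : (h^-1 * x == 1)%g = (x == h) by rewrite -[LHS](inj_eq (mulgI h)) mulVKg mulg1.
have -> : (h^-1 * x == s0)%g = (x == h * s0)%g by rewrite -[LHS](inj_eq (mulgI h)) mulVKg.
case: eqP => // _; case: eqP => _; first by rewrite mulg1.
by rewrite mulVKg.
Qed.

(* Moves not touching h preserve the value at h, and at most two moves touch
   it: splitting X according to that value halves the size at the cost of two
   in the degree. *)
Lemma swap_degree (m : nat) (X : {fset finperm H}) : s0 != 1%g -> X != fset0 ->
  (forall s, s \in X -> exists2 D : {fset H}, (m.*2 <= #|` D|)%N &
     forall h, h \in D -> (s * finperm_act h swap)%g \in X) ->
  (2 ^ m <= #|` X|)%N.
Proof.
move=> s01; elim: m X => [|m IH] X X0 degX.
  by rewrite expn0 lt0n cardfs_eq0.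
have /fset0Pn[s sX] := X0; have [D Dm DX] := degX s sX.
have /fset0Pn[h hD] : D != fset0 by rewrite -cardfs_eq0 -lt0n (leq_trans _ Dm).
have closed (P : pred H) : (exists2 t, t \in X & P (t h)) ->
    (2 ^ m <= #|` [fset t in X | P ((t : finperm H) h)]%fset|)%N.
  move=> [t tX Pt]; apply: IH.
    by apply/fset0Pn; exists t; rewrite !inE tX.
  move=> u; rewrite !inE/= => /andP[uX Pu].
  (* The swap at k moves h only for k = h and k = h s0^-1; discarding these two leaves at least
     [m.*2] of the [m.+1.*2] swaps. *)
  have [E Em EX] := degX u uX; exists (E `\ h `\ (h * s0^-1)%g)%fset.
    move: Em; rewrite doubleS (cardfsD1 h E) (cardfsD1 (h * s0^-1)%g (E `\ h)%fset).
    by case: (_ \in _); case: (_ \in _); rewrite ?add1n ?add0n => // /ltnW// /ltnW.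
  move=> k; rewrite !inE => /and3P[khs kh kE]; rewrite EX//=.
  rewrite -[translate _ _ _]/(finperm_act k swap h) act_swapE eq_sym (negbTE kh);
    case: eqP => // hks.
  by move: khs; rewrite hks -mulgA mulgV mulg1 eqxx.
have := closed (fun y => y == s h) _; have := closed (fun y => y != s h) _.
have -> : #|` X| = (#|` [fset t in X | (t : finperm H) h == s h]%fset| +
   #|` [fset t in X | (t : finperm H) h != s h]%fset|)%N.
  rewrite -!sum1_size (big_fsetID _ (fun t : finperm H => t h == s h) X)/=; congr addn.
rewrite expnS mul2n -addnn => c1 c2; apply: leq_add.
  by apply: c2; exists s; rewrite ?eqxx.
(* The swap at h changes the value at h from s h to s (h s0), so the second class is nonempty
   too. *)
apply: c1; exists (s * finperm_act h swap)%g; first exact: DX.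
have -> : (s * finperm_act h swap)%g h = s (finperm_act h swap h) by [].
rewrite act_swapE eqxx; apply/eqP => /(bij_inj (finperm_bij s)) hh.
by move: s01; rewrite -(inj_eq (mulgI h)) hh mulg1 eqxx.
Qed.

Definition lamp : shuffler H := Shuffle swap 1%g.

Lemma lampK : (lamp * lamp = 1)%g.
Proof.
congr Shuffle; last by rewrite mulg1.
apply: finpermP => x; rewrite /= /translate invg1 !mul1g; exact: swap_funK.
Qed.

End Swap.

(** The factor 8 is 4 * 2: a quarter of a fibre of more than y points provides the [m.*2] swaps that
    [swap_degree] requires, and the resulting 2 ^ m permutations contradict the size of A. *)
Lemma shuffler_isoperimetry (R : realType) (H : groupType) (S : seq H) (s0 : H)
    (r y : R) (m : nat) (A : {fset shuffler H}) :
  s0 != 1%g -> (8 * m)%:R <= y -> 1 <= y ->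
  (forall B : {fset H}, B != fset0 -> #|` B|%:R <= y ->
     #|` B|%:R <= r * (boundary S B)%:R) ->
  (#|` A| < 2 ^ m)%N ->
  #|` A|%:R <= 4 * (size S)%:R * r *
    (boundary (lamp s0 :: map (fun s => Shuffle 1%g s) S) A)%:R.
Proof.
move=> s01 my y1 isoH Am.
set l' := map _ S; set k : R := (size S)%:R.
(* A singleton has at most k outgoing edges, so its isoperimetry forces r k >= 1. *)
have rk : 1 <= r * k.
  have := isoH [fset 1%g]%fset; rewrite cardfs1 => /(_ _ y1) h.
  apply: (le_trans (h _)); first by apply/fset0Pn; exists 1%g; rewrite inE.
  rewrite /boundary big_seq_fset1 /outdeg.
  have r0 : 0 <= r.
    rewrite leNgt; apply/negP => r0.
    have : 1 <= r * (boundary S [fset 1%g]%fset)%:R :> R.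
      by apply: h; apply/fset0Pn; exists 1%g; rewrite inE.
    by apply/negP; rewrite -ltNge (@le_lt_trans _ _ 0)// mulr_le0_ge0// ltW.
  by rewrite ler_wpM2l// ler_nat count_size.
have k0 : 0 <= k by [].
have rk0 : 0 < r * k by rewrite (lt_le_trans ltr01).
rewrite leNgt; apply/negP => small.
(* With this e the negated conclusion says boundary < e #|A|; moreover r k >= 1 yields 2 e <= 1, so
   a lost move by the lamp costs no more in [cost] than in the boundary. *)
pose e : R := (4 * (r * k))^-1.
have e0 : 0 < e by rewrite invr_gt0 mulr_gt0.
have e4 : 4 * (r * k) * e = 1 by rewrite mulfV// gt_eqF// mulr_gt0.
have e1 : 2 * e <= 1 by rewrite -e4; nra.
pose q := @sh_perm H.
have ql a s : s \in l' -> q (a * s)%g = q a.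
  move=> /mapP[h _ ->]; rewrite /q /=.
  by rewrite -[RHS]mulg1 -[in RHS](finperm_act1 (sh_pos a)).
have qE a : q (a * lamp s0)%g = (q a * finperm_act (sh_pos a) (swap s0))%g by [].
have qt a : q (a * lamp s0)%g != q a.
  rewrite qE -[X in _ != X]mulg1 (inj_eq (mulgI _)); apply/eqP => E.
  have := act_swapE s0 (sh_pos a) (sh_pos a); rewrite E eqxx => /= hh.
  by move: s01; rewrite -(inj_eq (mulgI (sh_pos a))) mulg1 -hh eqxx.
have : \sum_(a <- A) cost l' (lamp s0) e A a < 0.
  rewrite (@le_lt_trans _ _ (\sum_(a <- A) (outdeg (lamp s0 :: l') A a)%:R - e * #|` A|%:R))//.
    rewrite -sum1_size natr_sum mulr_sumr -sumrB; apply: ler_sum => a _.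
    rewrite mulr1 /cost /outdeg /= natrD lerD2r addrC lerD2r.
    by case: (_ \in _) => //=; rewrite ?mulr0n ?mulr1n.
  have : e * (4 * k * r * (boundary (lamp s0 :: l') A)%:R) < e * #|` A|%:R by rewrite ltr_pM2l.
  rewrite -natr_sum subr_lt0 (_ : e * _ = 4 * (r * k) * e * (boundary (lamp s0 :: l') A)%:R).
    by rewrite e4 mul1r.
  ring.
move=> /(prune ql qt (lampK s0))[B [B0 BA BP]].
have posI x : {in fibre q B x &, injective (@sh_pos H)}.
  move=> [u h] [v h2]; rewrite !inE/= => /andP[_ /eqP ux] /andP[_ /eqP vx] hk.
  by rewrite -[u]/(q (Shuffle u h)) ux -[v]/(q (Shuffle v h2)) vx hk.
(* [sh_pos] embeds a fibre F in H with the same boundary, at most 3 e #|F|. If F had at most y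
   points, the hypothesis on H would give #|F| <= 3 r e #|F| <= 3/4 #|F|. *)
have big x : fibre q B x != fset0 -> y < #|` fibre q B x|%:R.
  set F := fibre q B x => F0; have [bF _] := prune_fibre ql e0 (BP x).
  pose F' := [fset sh_pos a | a in F]%fset.
  have cF : #|` F'| = #|` F| by rewrite card_in_imfset//; exact: posI.
  have cF0 : 0 < #|` F|%:R :> R by rewrite ltr0n lt0n cardfs_eq0.
  have bF' : boundary S F' = boundary l' F.
    rewrite /boundary big_imfset/=; last exact: posI.
    apply: eq_big_seq => a; rewrite !inE/= => /andP[aB /eqP qa].
    rewrite /outdeg count_map; apply: eq_count => s /=; congr negb.
    apply/imfsetP/idP => [[b bF0 E]|aF].
      suff -> : (a * Shuffle 1%g s)%g = b by [].
      have : q b = x by move: bF0; rewrite !inE/= => /andP[_ /eqP].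
      rewrite /q in qa *; case: a b E qa {aB bF0} => u h [v h2] /= <- -> ->.
      by rewrite -[LHS]/(Shuffle (x * finperm_act h 1)%g (h * s)%g) finperm_act1 mulg1.
    by exists (a * Shuffle 1%g s)%g.
  rewrite ltNge; apply/negP => Fy; have := isoH F'; rewrite cF bF'.
  rewrite -cardfs_eq0 cF cardfs_eq0 => /(_ F0 Fy) rF.
  have : 0 <= (boundary l' F)%:R :> R by [].
  have k1 : 1 <= k.
    rewrite /k ler1n lt0n; apply/eqP => S0; move: rk.
    by rewrite /k S0 mulr0 ler10.
  have r0 : 0 < r by nra.
  move=> b0; have : #|` F|%:R <= 3 * (r * e) * #|` F|%:R by nra.
  have : 4 * (r * e) <= 1 by nra.
  nra.
have : (2 ^ m <= #|` [fset q a | a in B]%fset|)%N.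
  apply: (swap_degree s01).
    have /fset0Pn[a aB] := B0; apply/fset0Pn; exists (q a).
    exact: in_imfset.
  move=> x /imfsetP[a aB ->]; set F := fibre q B (q a).
  have F0 : F != fset0 by apply/fset0Pn; exists a; rewrite !inE/= eqxx andbT.
  have [_] := prune_fibre ql e0 (BP (q a)).
  set N := [fset a in F | _]%fset => NF.
  exists [fset sh_pos a | a in N]%fset.
    rewrite card_in_imfset/=; last first.
      by apply: sub_in2 (posI (q a)) => u; rewrite !inE => /andP[].
    have := big _ F0; rewrite -/F -(leq_pmul2l (isT : 0 < 4)%N) -(ler_nat R) !natrM.
    move: my; rewrite natrM -muln2 natrM; lra.
  move=> h /imfsetP[b bN ->]; move: bN; rewrite !inE/= => /andP[/andP[bB /eqP <-] bt].
  by rewrite -qE; apply: in_imfset.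
move=> /(leq_trans)/(_ (leq_imfset_card _ _ _)) /leq_trans/(_ (fsubset_leq_card BA)).
by rewrite leqNgt Am.
Qed.

(** * Reduction of the exponent p to 1 *)

Section Powers.
Context {R : realType}.

Lemma bernoulli_sub (t : R) (n : nat) : 0 <= t -> t <= 1 -> 1 - t ^+ n <= n%:R * (1 - t).
Proof.
move=> t0 t1; elim: n => [|n IH]; first by rewrite expr0 subrr mul0r.
rewrite exprS -natr1 mulrDl mul1r.
have tn0 : 0 <= t ^+ n by rewrite exprn_ge0.
have tn1 : t ^+ n <= 1 by rewrite exprn_ile1.
nra.
Qed.

(** A mean value inequality with an integer n >= p as constant: dividing by a^p leaves t = b / a in
    [0, 1], where t^n <= t^p reduces the claim to Bernoulli. *)
Lemma powR_sub (p a b : R) (n : nat) : 1 <= p -> p <= n%:R -> 0 <= b -> b <= a ->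
  a `^ p - b `^ p <= n%:R * (a `^ (p - 1) * (a - b)).
Proof.
move=> p1 pn b0 ba; have p0 : 0 < p by rewrite (lt_le_trans ltr01).
have n0 : 0 <= n%:R :> R by [].
have n1 : 1 <= n%:R :> R by lra.
have a0 : 0 <= a by lra.
move: a0; rewrite le_eqVlt => /orP[/eqP a0|a0].
  have -> : b = a by lra.
  by rewrite !subrr !mulr0.
pose t := b / a; have bE : b = t * a by rewrite mulfVK// gt_eqF.
have t0 : 0 <= t by rewrite divr_ge0// ltW.
have t1 : t <= 1 by rewrite ler_pdivrMr// mul1r.
have tp : 1 - t `^ p <= n%:R * (1 - t).
  have [->|tn0] := eqVneq t 0; first by rewrite powR0 ?gt_eqF// !subr0 mulr1.
  apply: le_trans (bernoulli_sub n t0 t1); rewrite lerD2l lerN2 -powR_mulrn//.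
  by apply: ger_powR => //; rewrite lt_neqAle eq_sym tn0 t0 t1.
have -> : a `^ (p - 1) * (a - b) = a `^ p * (1 - t).
  by rewrite -(mulr_powRB1 (ltW a0) p0) bE; ring.
rewrite bE powRM ?(ltW a0)//.
have ap : 0 < a `^ p by rewrite powR_gt0.
rewrite -[X in X - _]mul1r -mulrBl mulrC mulrCA ler_wpM2l// ltW//.
Qed.

(* An elementary form of Young's inequality: compare a with lam * (a - b). *)
Lemma powR_sub_young (p a b lam : R) (n : nat) : 1 <= p -> p <= n%:R ->
  0 <= a -> 0 <= b -> 0 < lam ->
  `|a `^ p - b `^ p| <=
  n%:R * (lam `^ (p - 1) * `|a - b| `^ p + lam^-1 * (a `^ p + b `^ p)).
Proof.
move=> p1 pn; wlog ba : a b / b <= a.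
  move=> W a0 b0 l0; case: (leP b a) => [|/ltW] ab; first exact: W.
  by rewrite distrC [X in _ * (_ * X `^ _ + _)]distrC [X in _ * (_ + _ * X)]addrC;
    apply: W.
move=> a0 b0 l0; have p0 : 0 < p by rewrite (lt_le_trans ltr01).
have ab0 : 0 <= a - b by rewrite subr_ge0.
rewrite (ger0_norm ab0) ger0_norm; last first.
  by rewrite subr_ge0 ge0_ler_powR ?nnegrE// ltW.
apply: (le_trans (powR_sub p1 pn b0 ba)); apply: ler_wpM2l => //.
have A0 := powR_ge0 a (p - 1).
(* If lam (a - b) <= a, the factor a - b is traded for a / lam; otherwise a < lam (a - b) bounds
   a^(p-1). *)
case: (leP ((a - b) * lam) a) => h.
  apply: (@le_trans _ _ (lam^-1 * a `^ p)).
    rewrite -(mulr_powRB1 a0 p0) mulrA mulrC ler_wpM2r//.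
    by rewrite mulrC ler_pdivlMr.
  rewrite mulrDr addrCA lerDl addr_ge0// mulr_ge0 ?powR_ge0// invr_ge0 ltW//.
apply: (@le_trans _ _ (lam `^ (p - 1) * (a - b) `^ p)); last first.
  by rewrite lerDl mulr_ge0 ?addr_ge0 ?powR_ge0// invr_ge0 ltW.
rewrite -(mulr_powRB1 ab0 p0) [X in _ <= _ * X]mulrC mulrA ler_wpM2r//.
rewrite -powRM ?(ltW l0)//; apply: ge0_ler_powR; rewrite ?nnegrE ?subr_ge0//.
- by rewrite mulr_ge0// ltW.
- by rewrite mulrC ltW.
Qed.

End Powers.

Section PowerEnergy.
Context {R : realType} {G : groupType}.
Implicit Types (f : G -> R) (p : R).

Lemma mass_powR p f : mass 1 (fun g => `|f g| `^ p) = mass p f.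
Proof. by apply: eq_fsbigr => g _; rewrite powRr1// ger0_norm// powR_ge0. Qed.

(** Sums the pointwise Young inequality over all edges; by translation invariance each s contributes
    the mass twice. *)
Lemma energy_powR p lam (T : seq G) f (n : nat) : 1 <= p -> p <= n%:R -> 0 < lam ->
  (forall g, 0 <= f g) -> finite_set (supp f) ->
  energy 1 T (fun g => f g `^ p) <=
  n%:R * (lam `^ (p - 1) * energy p T f + 2 * (size T)%:R * lam^-1 * mass p f).
Proof.
move=> p1 pn l0 f0 finf; have p0 : 0 < p by rewrite (lt_le_trans ltr01).
have finp : finite_set (supp (fun g => f g `^ p)).
  rewrite (_ : (fun g => _) = fun g => `|f g| `^ p); first exact: supp_pow.
  by apply/funext => g; rewrite ger0_norm.
rewrite energyE// energyE//.
have -> : n%:R * (lam `^ (p - 1) * \sum_(s <- T) energy p [:: s] f +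
    2 * (size T)%:R * lam^-1 * mass p f) =
    \sum_(s <- T) n%:R * (lam `^ (p - 1) * energy p [:: s] f + lam^-1 * (mass p f + mass p f)).
  rewrite -mulr_sumr big_split/= -mulr_sumr big_const_seq iter_addr_0 count_predT -mulr_natr.
  by congr (_ * (_ + _)); ring.
apply: ler_sum => s _.
have massE : mass p f = \sum_(g \in [set: G]) f (g * s)%g `^ p.
  rewrite (fsum_translate (fun g => f g `^ p)); apply: eq_fsbigr => g _.
  by rewrite ger0_norm.
have massE' : mass p f = \sum_(g \in [set: G]) f g `^ p.
  by apply: eq_fsbigr => g _; rewrite ger0_norm.
have finT := supp_translate (F := fun g => f g `^ p) s finp.
rewrite {1}massE' massE !energy1E -fsumD; [|exact: finp|exact: finT].
have finD := supp_dpow s p0 finf.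
have finS : finite_set (supp (fun g => f g `^ p + f (g * s)%g `^ p)).
  by apply: supp_op2 finp finT; rewrite addr0.
rewrite !mulr_fsumr -fsumD.
- rewrite mulr_fsumr; apply: ler_fsum.
  + by apply: supp_dpow.
  + by apply: (supp_op2 (op := fun u v => n%:R * (lam `^ (p - 1) * u + lam^-1 * v)));
    rewrite ?mulr0 ?addr0 ?mulr0.
  + by move=> g; rewrite powRr1//; apply: powR_sub_young.
- by apply: (supp_op2 (op := fun u v => lam `^ (p - 1) * u) _ finD finD); rewrite mulr0.
- by apply: (supp_op2 (op := fun u v => lam^-1 * u) _ finS finS); rewrite mulr0.
Qed.

(** The positive parts of differences produced by [coarea] are at most their absolute values. *)
Lemma mass_coarea (l : seq G) (c : R) f (D : {fset G}) : 0 <= c ->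
  (forall g, 0 <= f g) -> (forall g, g \notin D -> f g = 0) ->
  (forall A : {fset G}, A != fset0 -> (A `<=` D)%fset ->
     #|` A|%:R <= c * (boundary l A)%:R) ->
  mass 1 f <= c * energy 1 l f.
Proof.
move=> c0 f0 fD iso.
have finf : finite_set (supp f).
  apply: (@sub_finite_set _ _ [set` D]) => // g /= fg.
  by apply: contraNT fg => /fD ->; rewrite /supp /=.
have := coarea c0 f0 fD iso; rewrite /mass.
rewrite (@fsbigTE _ _ _ _ D); last by move=> g /fD ->; rewrite normr0 powR0// oner_neq0.
move=> h; apply: le_trans (le_trans _ h) _.
  by apply: ler_sum => g _; rewrite powRr1// ger0_norm.
apply: ler_wpM2l => //; rewrite /energy.
pose e g : R := if g \in D then \sum_(s <- l) Num.max (f g - f (g * s)%g) 0 else 0.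
have -> : \sum_(g <- D) \sum_(s <- l) Num.max (f g - f (g * s)%g) 0 =
    \sum_(g \in [set: G]) e g.
  rewrite (@fsbigTE _ _ _ _ D) => [|g /negbTE gD]; last by rewrite /e gD.
  by apply: eq_big_seq => g gD; rewrite /e gD.
apply: ler_fsum.
- apply: (@sub_finite_set _ _ [set` D]) => // g /=; rewrite /supp /e /=.
  by case: ifP => //; rewrite eqxx.
- by apply: supp_sum => s; apply: supp_dpow.
- move=> g; rewrite /e; case: ifP => _; last by apply: sumr_ge0 => s _; apply: powR_ge0.
  by apply: ler_sum => s _; rewrite powRr1// ge_max ler_norm/=.
Qed.

(** For each s, as many edges enter B as leave it, because B and its translate have the same size;
    hence the factor 2. *)
Lemma energy_indicator (l : seq G) (B : {fset G}) :
  energy 1 l (fun g => (g \in B)%:R) <= 2 * (boundary l B)%:R :> R.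
Proof.
pose f g : R := (g \in B)%:R.
have finB : finite_set (supp f).
  apply: (@sub_finite_set _ _ [set` B]) => // g /=; rewrite /supp /f /=.
  by case: (g \in B); rewrite ?eqxx.
rewrite energyE// /boundary /outdeg.
have -> : (\sum_(g <- B) count (fun s => (g * s)%g \notin B) l)%N%:R =
    \sum_(s <- l) \sum_(g <- B) ((g * s)%g \notin B)%:R :> R.
  rewrite natr_sum exchange_big/=; apply: eq_bigr => g _.
  by rewrite -sum1_count natr_sum big_mkcond/=; apply: eq_bigr => s _; case: (_ \in _).
rewrite mulr_sumr; apply: ler_sum => s _; rewrite energy1E.
pose u g : R := f g * ((g * s)%g \notin B)%:R.
have uE : \sum_(g <- B) ((g * s)%g \notin B)%:R = \sum_(g \in [set: G]) u g :> R.
  rewrite (@fsbigTE _ _ _ _ B) => [|g /negbTE gB]; last by rewrite /u /f gB mul0r.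
  by apply: eq_big_seq => g gB; rewrite /u /f gB mul1r.
have finu : finite_set (supp u).
  apply: sub_finite_set finB => g /=; rewrite /supp /u /=.
  by apply: contraNN => /eqP ->; rewrite mul0r.
have finBs := supp_translate s finB.
have -> : \sum_(g \in [set: G]) `|f g - f (g * s)%g| `^ 1 =
    \sum_(g \in [set: G]) (2 * u g + (- f g + f (g * s)%g)).
  apply: eq_fsbigr => g _; rewrite powRr1// /u /f.
  case: (g \in B); case: (_ \in B) => /=;
    rewrite ?subrr ?sub0r ?subr0 ?normrN ?normr0 ?normr1; ring.
have fin2u : finite_set (supp (fun g => 2 * u g)).
  by apply: (supp_op2 (op := fun v _ => 2 * v) _ finu finu); rewrite mulr0.
have finN : finite_set (supp (fun g => - f g)).
  by apply: (supp_op2 (op := fun v _ => - v) _ finB finB); rewrite oppr0.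
rewrite fsumD//; last by apply: supp_op2; rewrite ?addr0.
rewrite [X in _ + X]fsumD// (fsum_translate f) -fsumD//.
rewrite [X in _ + X]fsbig1 => [|g _]; last by rewrite addNr.
by rewrite addr0 uE mulr_fsumr.
Qed.

End PowerEnergy.

(** * Upper bound on the profile *)

Section ProfileBounds.
Context {R : realType} {G : groupType}.
Implicit Types (f : G -> R) (p r x : R) (S : {fset G}).

Lemma mass_gt0 p x f : 0 < p -> admissible x f -> 0 < mass p f.
Proof.
move=> p0 [f0 [g fg] finf _]; rewrite /mass (fsum_supp (D := supp f))//; last first.
  move=> h /=; rewrite /supp /=; apply: contraNN => /eqP ->.
  by rewrite normr0 powR0// gt_eqF.
rewrite (big_fsetD1 g)/=; last by rewrite in_fset_set// inE.
rewrite ltr_pwDl ?powR_gt0 ?normr_gt0//.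
by apply: sumr_ge0 => h _; apply: powR_ge0.
Qed.

Lemma powR_invK p (a : R) : 0 < p -> 0 <= a -> (a `^ p^-1) `^ p = a.
Proof. by move=> p0 a0; rewrite -powRrM mulVf ?gt_eqF// powRr1. Qed.

Lemma powRK_inv p (a : R) : 0 < p -> 0 <= a -> (a `^ p) `^ p^-1 = a.
Proof. by move=> p0 a0; rewrite -powRrM mulfV ?gt_eqF// powRr1. Qed.

(** Replaces the extended supremum by real inequalities. An admissible function of zero energy has
    positive mass, hence ratio +oo, and violates both sides. *)
Lemma profile_leP p S x r : 0 < p -> 0 <= r ->
  (profile p S x <= r%:E)%E <->
  forall f, admissible x f -> mass p f <= r `^ p * energy p S f.
Proof.
move=> p0 r0; split=> [h f fx|h].
  have N0 := mass_gt0 p0 fx.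
  have E0 := energy_ge0 p S f.
  have : ((lp_norm p f)%:E / (lp_grad p S f)%:E <= r%:E)%E.
    by apply: le_trans h; apply: ereal_sup_ubound; exists f.
  rewrite -[lp_norm p f]/(mass p f `^ p^-1) -[lp_grad p S f]/(energy p S f `^ p^-1).
  rewrite inver; case: eqP => [_|/eqP b0].
    by rewrite gt0_muley ?lte_fin ?powR_gt0// leye_eq.
  have {}b0 : 0 < energy p S f `^ p^-1 by rewrite lt_neqAle eq_sym b0 powR_ge0.
  rewrite -EFinM lee_fin ler_pdivrMr// => ab.
  have := ge0_ler_powR (ltW p0) _ _ ab.
  rewrite !nnegrE powR_ge0 mulr_ge0 ?(ltW b0)// => /(_ isT isT).
  by rewrite powRM ?(ltW b0)// !powR_invK// ltW.
apply: ge_ereal_sup => _ [f fx <-].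
have N0 := mass_gt0 p0 fx; have E0 := energy_ge0 p S f.
rewrite -[lp_norm p f]/(mass p f `^ p^-1) -[lp_grad p S f]/(energy p S f `^ p^-1).
have NE := h f fx.
have E1 : 0 < energy p S f.
  rewrite lt_neqAle E0 andbT eq_sym; apply/eqP => E1.
  by move: NE; rewrite E1 mulr0 leNgt N0.
have b0 : 0 < energy p S f `^ p^-1 by rewrite powR_gt0.
rewrite inver gt_eqF// -EFinM lee_fin ler_pdivrMr//.
have pV : 0 <= p^-1 by rewrite invr_ge0 ltW.
have := ge0_ler_powR pV _ _ NE.
rewrite !nnegrE mulr_ge0 ?powR_ge0 ?(ltW N0)// => /(_ isT isT).
by rewrite powRM ?powR_ge0// powRK_inv.
Qed.

Lemma supp_indicator (B : {fset G}) :
  supp (fun g => (g \in B)%:R : R) = [set` B].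
Proof.
apply/seteqP; split=> g /=; rewrite /supp /=; first by case: (g \in B); rewrite ?eqxx.
by move=> ->; rewrite oner_neq0.
Qed.

Lemma admissible_indicator x (B : {fset G}) : B != fset0 -> #|` B|%:R <= x ->
  admissible x (fun g => (g \in B)%:R).
Proof.
move=> /fset0Pn[b bB] Bx; split; rewrite ?supp_indicator ?set_fsetK//.
by exists b; rewrite bB oner_neq0.
Qed.

(** For x >= 1 the indicator of the identity is admissible; for x < 1 no function is, and the
    supremum is -oo. *)
Lemma profile_ge0 p S x : 1 <= x -> (0 <= profile p S x)%E.
Proof.
move=> x1; pose f (g : G) : R := (g \in [fset 1%g]%fset)%:R.
apply: (@le_trans _ _ ((lp_norm p f)%:E / (lp_grad p S f)%:E)%E).
  by rewrite mule_ge0 ?inve_ge0 ?lee_fin ?powR_ge0.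
apply: ereal_sup_ubound; exists f => //; apply: admissible_indicator.
  by apply/fset0Pn; exists 1%g; rewrite inE.
by rewrite cardfs1.
Qed.

Lemma profile_mono p S x y : x <= y -> (profile p S x <= profile p S y)%E.
Proof.
move=> xy; apply: ge_ereal_sup => _ [f [f0 f1 finf fx] <-].
apply: ereal_sup_ubound; exists f => //; split=> //; exact: le_trans fx xy.
Qed.

Lemma mass_indicator (B : {fset G}) :
  mass 1 (fun g => (g \in B)%:R) = #|` B|%:R :> R.
Proof.
rewrite /mass (@fsbigTE _ _ _ _ B); last first.
  by move=> g /negbTE ->; rewrite normr0 powR0// oner_neq0.
rewrite -sum1_size natr_sum; apply: eq_big_seq => g ->.
by rewrite normr1 powR1.
Qed.

Lemma profile_isoperimetry S x r : 0 <= r -> (profile 1 S x <= r%:E)%E ->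
  forall B : {fset G}, B != fset0 -> #|` B|%:R <= x ->
  #|` B|%:R <= 2 * r * (boundary S B)%:R.
Proof.
move=> r0 /(profile_leP _ _ ltr01 r0) h B B0 Bx.
have := h _ (admissible_indicator B0 Bx).
rewrite mass_indicator powRr1// => /le_trans; apply.
rewrite -mulrA mulrCA ler_wpM2l//; exact: energy_indicator.
Qed.

End ProfileBounds.

(** Reduces a bound by a possibly infinite profile to bounds by the reals above it, to which
    [profile_leP] applies. *)
Lemma lee_scale (R : realType) (K : R) (u v : \bar R) : 0 < K -> (0 <= v)%E ->
  (forall r, 0 <= r -> (v <= r%:E)%E -> (u <= (K * r)%:E)%E) ->
  (u <= K%:E * v)%E.
Proof.
case: v => [r||] K0 //=; last by move=> _ _; rewrite gt0_muley ?lte_fin// leey.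
by rewrite lee_fin -EFinM => r0; apply.
Qed.

(** As log2 x >= 1, one gets m > 2 log2 x - 1 >= log2 x. *)
Lemma ltr_exp2_of_ln (R : realType) (x : R) (m : nat) : 2 <= x ->
  2 * ln x / ln 2 < m.+1%:R -> x < (2 ^ m)%:R.
Proof.
move=> x2; have x0 : 0 < x by lra.
have l2 : 0 < ln 2 :> R by rewrite ln_gt0// ltr1n.
have lx : ln 2 <= ln x by rewrite ler_ln ?posrE.
rewrite ltr_pdivrMr// => h.
have mE : m.+1%:R = m%:R + 1 :> R by rewrite natr1.
rewrite mE in h; rewrite natrX -ltr_ln ?posrE ?exprn_gt0// lnXn//.
rewrite -[X in _ < X]mulr_natl; lra.
Qed.

(* Young's inequality is applied at a scale lam proportional to the value r of
   the profile of H, so that the mass term can be absorbed on the left. *)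
Lemma profile_shuffler_le (R : realType) (p : R) (H : groupType)
    (S : {fset H}) (T : {fset shuffler H}) :
  1 <= p -> generates T ->
  exists K c : R, [/\ 0 < K, 0 < c &
    forall x, 2 <= x -> (profile p T x <= K%:E * profile 1 S (c * ln x))%E].
Proof.
move=> p1 genT; have p0 : 0 < p by rewrite (lt_le_trans ltr01).
have l2 : 0 < ln 2 :> R by rewrite ln_gt0// ltr1n.
(* Chosen so that, for y = c ln x and m the integer part of y / 8, m + 1 > y / 8 = 2 ln x / ln 2,
   whence x < 2^m. *)
pose c : R := 16 / ln 2; have c0 : 0 < c by rewrite divr_gt0.
have cx x : 2 <= x -> 16 <= c * ln x.
  move=> x2; rewrite /c mulrAC ler_pdivlMr// ler_wpM2l// ler_ln ?posrE//; lra.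
(* In the trivial group the singleton has no boundary, so the profile of H is +oo and the estimate
   is vacuous. *)
have [[s0 s01]|triv] := pselect (exists s0 : H, s0 != 1%g); last first.
  exists 1, c; split=> // x x2; have cx2 := cx x x2.
  apply: lee_scale => //; first by apply: profile_ge0; lra.
  move=> r r0 /(profile_isoperimetry r0) isoH; exfalso.
  have B0 : [fset 1%g]%fset != fset0 :> {fset H}.
    by apply/fset0Pn; exists 1%g; rewrite inE.
  have := isoH _ B0; rewrite cardfs1 (_ : boundary S _ = 0%N).
    rewrite mulr0 ler10 => F; suff : false by []; apply: F; lra.
  rewrite /boundary big_seq_fset1 /outdeg (eq_count (a2 := pred0)) ?count_pred0// => s /=.
  rewrite inE; apply/negbTE; rewrite negbK.
  by apply: (contra_notT _ triv) => ns; exists (1 * s)%g.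
set l := lamp s0 :: map (fun s => Shuffle 1%g s) S.
have [C1 C10 C1P] := @energy_words R _ 1 T l ltr01 genT.
pose n := (Num.truncn p).+1.
have pn : p <= n%:R by rewrite ltW// truncnS_gt.
(* Collects 4 #|S| * 2 from isoperimetry, C1 from the change of generators and n from Young's
   inequality. *)
pose kap : R := 8 * (size S)%:R * C1 * n%:R.
have kap0 : 0 <= kap by rewrite !mulr_ge0.
pose tT : R := (size T)%:R; have tT0 : 0 <= tT by [].
(* With lam = K0 r the mass term gets the coefficient 2 tT kap / K0 <= 1/2; the 1 keeps K0
   positive. *)
pose K0 := 4 * tT * kap + 1.
have K00 : 0 < K0 by rewrite ltr_wpDl// !mulr_ge0.
pose K := 2 * kap + K0.
(* K dominates both 2 kap, which occurs to the first power, and K0, which occurs to the power p -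
   1. *)
have K1 : 0 < K by rewrite ltr_wpDl// mulr_ge0.
exists K, c; split=> // x x2; have cx2 := cx x x2.
set y := c * ln x; have y1 : 1 <= y by rewrite /y; lra.
apply: lee_scale => //; first exact: profile_ge0.
move=> r r0 /(profile_isoperimetry r0) isoH.
(* Isoperimetry of the singleton excludes r = 0; this makes lam positive. *)
have rp : 0 < r.
  rewrite lt_neqAle r0 andbT eq_sym; apply/eqP => rE.
  have := isoH [fset 1%g]%fset; rewrite cardfs1 rE mulr0 mul0r ler10 => F.
  suff : false by [].
  by apply: F; [apply/fset0Pn; exists 1%g; rewrite inE|rewrite /y; lra].
pose m := Num.truncn (y / 8).
have y8 : 0 <= y / 8 by rewrite /y; lra.
have my : (8 * m)%:R <= y.
  by rewrite natrM mulrC -ler_pdivlMr// truncn_le.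
have xm : x < (2 ^ m)%:R.
  apply: ltr_exp2_of_ln => //; rewrite (_ : _ / _ = y / 8) ?truncnS_gt//.
  by rewrite /y /c; field; rewrite gt_eqF.
have Kr0 : 0 <= K * r by rewrite mulr_ge0// ltW.
apply/(profile_leP _ _ p0 Kr0) => f fx; have [f0 _ finf fcard] := fx.
have absf g : `|f g| = f g by rewrite ger0_norm.
have N0 := mass_ge0 p f; have E0 := energy_ge0 p T f.
pose lam := K0 * r; have lam0 : 0 < lam by rewrite mulr_gt0.
have finF : finite_set (supp (fun g => f g `^ p)).
  rewrite (_ : (fun g => _) = fun g => `|f g| `^ p); first exact: supp_pow.
  by apply/funext => g; rewrite absf.
have key : mass p f <= kap * r * (lam `^ (p - 1) * energy p T f + 2 * tT * lam^-1 * mass p f).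
  rewrite -[X in X <= _]mass_powR.
  have -> : (fun g => `|f g| `^ p) = fun g => f g `^ p by apply/funext => g;
    rewrite absf.
  have ciso0 : 0 <= 4 * (size S)%:R * (2 * r) by rewrite !mulr_ge0.
  apply: (le_trans (@mass_coarea _ _ l _ _ (fset_set (supp f)) ciso0 _ _ _)).
  - by move=> g; apply: powR_ge0.
  - move=> g; rewrite in_fset_set// notin_setE /supp /= => /negP;
    rewrite negbK => /eqP ->.
    by rewrite powR0// gt_eqF.
  - move=> A A0 AD; apply: (shuffler_isoperimetry s01 my y1 isoH).
    rewrite -(ltr_nat R); apply: le_lt_trans xm; apply: le_trans fcard.
    by rewrite ler_nat fsubset_leq_card.
  have := energy_powR T p1 pn lam0 f0 finf; set Y := _ + _ => EY.
  apply: (le_trans (ler_wpM2l ciso0 (C1P _ finF))).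
  apply: (le_trans (ler_wpM2l ciso0 (ler_wpM2l C10 EY))).
  by rewrite /kap le_eqVlt; apply/orP; left; apply/eqP; ring.
have lamE : kap * r * (2 * tT * lam^-1 * mass p f) <= 2^-1 * mass p f.
  rewrite !mulrA; apply: ler_wpM2r => //; rewrite ler_pdivrMr// /lam /K0; clear -rp;
    lra.
have half : mass p f <= 2 * kap * r * (lam `^ (p - 1) * energy p T f).
  rewrite mulrDr in key.
  have -> : 2 * kap * r * (lam `^ (p - 1) * energy p T f) =
      2 * (kap * r * (lam `^ (p - 1) * energy p T f)) by rewrite !mulrA.
  have absorb (N u v : R) : N <= u + v -> v <= 2^-1 * N -> N <= 2 * u.
    by move=> h1 h2; clear -h1 h2; lra.
  exact: absorb key lamE.
apply: (le_trans half); rewrite mulrA; apply: ler_wpM2r => //.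
rewrite -(mulr_powRB1 Kr0 p0); apply: ler_pM; rewrite ?powR_ge0 ?mulr_ge0//.
  by apply: ler_wpM2r => //; rewrite /K lerDl ltW.
apply: ge0_ler_powR; rewrite ?nnegrE ?subr_ge0// ?(ltW lam0)//.
by apply: ler_wpM2r => //; rewrite /K lerDr mulr_ge0.
Qed.

(** * Lower bound on the profile *)

Lemma cardfsM (I J : choiceType) (A : {fset I}) (B : {fset J}) :
  #|` (A `*` B)%fset| = (#|` A| * #|` B|)%N.
Proof.
rewrite -(size_allpairs (fun x y => (x, y)) A B); apply/perm_size/uniq_perm.
- exact: fset_uniq.
- by apply: allpairs_uniq => //; [move=> [x y] [x' y'] _ _ /= ->].
- move=> [x y]; rewrite in_fsetM;
  apply/andP/allpairsP => [[xA yB]|[[u v] [uA vB [-> ->]]]//].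
  by exists (x, y).
Qed.

Section Lift.
Context {R : realType} {H : groupType}.
Implicit Types (V D : {fset H}) (s : finperm H) (f : H -> R) (p : R).

Definition perm_on V s : bool := `[< forall x, s x <> x -> x \in V >].

Lemma perm_onP V s : reflect (forall x, s x <> x -> x \in V) (perm_on V s).
Proof. exact: asboolP. Qed.

Lemma perm_on_stable V s x : perm_on V s -> x \in V -> s x \in V.
Proof.
move=> /perm_onP sV xV; case: (pselect (s x = x)) => [->//|sx].
by apply: sV => /(bij_inj (finperm_bij s)).
Qed.

Lemma perm_on1 V : perm_on V 1%g.
Proof. by apply/perm_onP => x /=. Qed.

Lemma perm_onM V s (t : finperm H) : perm_on V t -> perm_on V (s * t)%g = perm_on V s.
Proof.
move=> tV; apply/perm_onP/perm_onP => sV x sx.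
  case: (pselect (x \in V)) => // xV.
  have tx : t x = x.
    by have [//|/(elimT (perm_onP _ _) tV)] := pselect (t x = x).
  by apply: sV; rewrite -[X in X <> _]/(s (t x)) tx.
have [tx|/(elimT (perm_onP _ _) tV)//] := pselect (t x = x).
by apply: sV; move: sx; rewrite -[X in X <> _]/(s (t x)) tx.
Qed.

(** A permutation supported in V preserves V and is determined by its restriction, so there are at
    most as many as maps from V to V. *)
Lemma perm_on_fset V : exists2 P : {fset finperm H},
  (forall s, (s \in P) = perm_on V s) & (#|` P| <= #|` V| ^ #|` V|)%N.
Proof.
pose phi (s : finperm H) : {ffun V -> V} := [ffun v => insubd v (s (val v))].
have phi_inj s t : perm_on V s -> perm_on V t -> phi s = phi t -> s = t.
  move=> sV tV st; apply: finpermP => x; have [xV|xV] := boolP (x \in V).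
    have /(congr1 val) := congr1 (fun g : {ffun V -> V} => g [` xV]%fset) st.
    by rewrite /phi !ffunE !val_insubd/= !perm_on_stable.
  have fixV u : perm_on V u -> u x = x.
    move=> /perm_onP uV; case: (pselect (u x = x)) => // /uV.
    by rewrite (negbTE xV).
  by rewrite !fixV.
(* Inverse of [phi] on restrictions of permutations; other maps get the default 1. *)
pose psi (g : {ffun V -> V}) : finperm H := xget 1%g [set s | perm_on V s /\ phi s = g].
exists [fset psi g | g : {ffun V -> V} & perm_on V (psi g)]%fset.
  move=> s; apply/imfsetP/idP => [[g] /= gV ->|sV]; first by move: gV; rewrite inE.
  have psiE : psi (phi s) = s.
    by rewrite /psi; apply: xget_unique => // t [tV ts]; apply: phi_inj.
  exists (phi s); last by rewrite psiE.
  by rewrite inE psiE; apply/perm_onP.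
apply: (leq_trans (leq_imfset_card _ _ _)) => /=.
rewrite size_filter (leq_trans (count_size _ _))//.
by rewrite -cardE card_ffun -!cardfE.
Qed.

Lemma fsum_shuffler V (P : {fset finperm H}) (K : H -> R) :
  finite_set (supp K) ->
  \sum_(a \in [set: shuffler H]) ((sh_perm a \in P)%:R * K (sh_pos a)) =
  #|` P|%:R * \sum_(h \in [set: H]) K h.
Proof.
move=> finK; pose h (x : finperm H * H) := Shuffle x.1 x.2.
have hbij : bijective h.
  by exists (fun a => (sh_perm a, sh_pos a)) => [[]|[]].
rewrite (reindex_fsbigT h _ hbij)/=.
rewrite -(@fsbig_widen _ _ _ _ ([set` P] `*` supp K) setT)//; last first.
  move=> [s k] [_]; rewrite /= => /not_andP[|] /negP nP.
    by rewrite (negbTE nP) mul0r.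
  by move: nP; rewrite /supp /= negbK => /eqP ->; rewrite mulr0.
rewrite -(@pair_fsbig _ _ _ _ _ [set` P] (supp K) (fun s k => (s \in P)%:R * K k))//.
rewrite -(@fsbig_widen _ _ _ _ (supp K) setT)//; last first.
  by move=> k [_]; rewrite /supp /= => /negP; rewrite negbK => /eqP.
rewrite -fsbig_seq// -sum1_size natr_sum mulr_suml; apply: eq_big_seq => s sP.
by rewrite sP mul1r; apply: eq_fsbigr => k _; rewrite mul1r.
Qed.

Definition shuffler_lift V f (a : shuffler H) : R := (perm_on V (sh_perm a))%:R * f (sh_pos a).

Lemma mass_shuffler_lift p V f (P : {fset finperm H}) : 0 < p ->
  (forall s, (s \in P) = perm_on V s) -> finite_set (supp f) ->
  mass p (shuffler_lift V f) = #|` P|%:R * mass p f.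
Proof.
move=> p0 PV finf; rewrite /mass -fsum_shuffler//; last exact: supp_pow.
apply: eq_fsbigr => a _; rewrite /shuffler_lift PV; case: (perm_on _ _).
  by rewrite !mul1r.
by rewrite !mul0r normr0 powR0// gt_eqF.
Qed.

(* Right multiplication by (t, k) modifies s at h inside h * supp t; V must
   absorb this both when h and when h * k lies in the support of f. *)
Lemma energy_shuffler_lift p V f (P : {fset finperm H}) (T : seq (shuffler H)) : 0 < p ->
  (forall s, (s \in P) = perm_on V s) -> finite_set (supp f) ->
  (forall (t : shuffler H) h, t \in T -> (f h != 0) || (f (h * sh_pos t)%g != 0) ->
     perm_on V (finperm_act h (sh_perm t))) ->
  energy p T (shuffler_lift V f) = #|` P|%:R * energy p (map (@sh_pos H) T) f.
Proof.
move=> p0 PV finf TV; rewrite /energy -fsum_shuffler//; last first.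
  by apply: supp_sum => s; apply: supp_dpow.
apply: eq_fsbigr => a _; rewrite big_map mulr_sumr; apply: eq_big_seq => t tT.
rewrite /shuffler_lift PV /=.
have [nz|] := boolP ((f (sh_pos a) != 0) || (f (sh_pos a * sh_pos t)%g != 0)).
  rewrite perm_onM ?TV//; case: (perm_on _ _); first by rewrite !mul1r.
  by rewrite !mul0r subrr normr0 powR0// gt_eqF.
rewrite negb_or !negbK => /andP[/eqP -> /eqP ->].
by rewrite !mulr0 subrr normr0 powR0 ?mulr0// gt_eqF.
Qed.

Lemma admissible_shuffler_lift x V f (P : {fset finperm H}) :
  (forall s, (s \in P) = perm_on V s) -> admissible x f ->
  admissible (#|` P|%:R * x) (shuffler_lift V f).
Proof.
move=> PV [f0 [h fh] finf fx].
pose Q := [fset Shuffle y.1 y.2 | y in (P `*` fset_set (supp f))%fset]%fset.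
have QE a : shuffler_lift V f a != 0 -> a \in Q.
  rewrite /shuffler_lift; case: (boolP (perm_on _ _)); last by rewrite mul0r eqxx.
  rewrite mul1r => aV fa; apply/imfsetP; exists (sh_perm a, sh_pos a) => /=;
    last by case: (a).
  by rewrite inE/= PV aV in_fset_set// inE.
have finl : finite_set (supp (shuffler_lift V f)) by apply: (@sub_finite_set _ _ [set` Q]).
split=> //.
- by move=> a; rewrite mulr_ge0.
- by exists (Shuffle 1%g h); rewrite /shuffler_lift/= perm_on1 mul1r.
- apply: (@le_trans _ _ (#|` P|%:R * #|` fset_set (supp f)|%:R));
  last by rewrite ler_wpM2l.
  have Qcard : (#|` Q| <= #|` P| * #|` fset_set (supp f)|)%N.
    by rewrite -cardfsM; apply: leq_imfset_card.
  rewrite -natrM ler_nat; apply: leq_trans Qcard.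
  by apply: fsubset_leq_card; apply/fsubsetP => a; rewrite in_fset_set// inE => /QE.
Qed.

End Lift.

(** The condition on x bounds the support of the lift: at most y positions and, since #|V| <= u y,
    at most (u y)^(u y) permutations. *)
Lemma profile_shuffler_ge (R : realType) (p : R) (H : groupType)
    (S : {fset H}) (T : {fset shuffler H}) :
  1 <= p -> generates S ->
  exists K u : R, [/\ 0 < K, 1 <= u &
    forall y x, 1 <= y -> y * (u * y) `^ (u * y) <= x ->
      (profile p S y <= K%:E * profile p T x)%E].
Proof.
move=> p1 genS; have p0 : 0 < p by rewrite (lt_le_trans ltr01).
have [C C0 CP] := energy_words (R := R) (p := p) (map (@sh_pos H) T) p0 genS.
pose moved (t : shuffler H) := [set x | sh_perm t x <> x].
(* The sites a generator disturbs, relative to its start h, and relative to its end for the case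
   where it is the end that lies in the support of f. *)
pose W : set H := \bigcup_(t in [set` T])
  (moved t `|` [set ((sh_pos t)^-1 * x)%g | x in moved t]).
have finW : finite_set W.
  apply: bigcup_finite => // t _; rewrite finite_setU; split; first exact: finperm_fin.
  by apply: finite_image; exact: finperm_fin.
(* The successor makes u >= 1 even when [W] is empty. *)
pose U := fset_set W; pose u : R := (#|` U|.+1)%:R.
have u1 : 1 <= u by rewrite ler1n.
exists ((1 + C) `^ p^-1), u; split=> //; first by rewrite powR_gt0// ltr_pwDl.
move=> y x y1 yx; have y0 : 0 <= y by lra.
have uy1 : 1 <= u * y by nra.
have x1 : 1 <= x.
  have : 1 <= (u * y) `^ (u * y).
    by rewrite -(powRr0 (u * y)); apply: ler_powR => //; lra.
  by move=> z; apply: le_trans yx; nra.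
apply: lee_scale; [by rewrite powR_gt0// ltr_pwDl|exact: profile_ge0|].
move=> r r0 /(profile_leP _ _ p0 r0) hT.
have Kr0 : 0 <= (1 + C) `^ p^-1 * r by rewrite mulr_ge0// powR_ge0.
apply/(profile_leP _ _ p0 Kr0) => f fy; have [f0 _ finf fcard] := fy.
pose F := fset_set (supp f).
pose V := [fset (z.1 * z.2)%g | z in (F `*` U)%fset]%fset.
have memU b : W b -> b \in U by move=> Wb; rewrite in_fset_set// inE.
have memV a b : f a != 0 -> b \in U -> (a * b)%g \in V.
  move=> fa bU; apply/imfsetP; exists (a, b) => //=.
  have aF : a \in F by rewrite in_fset_set// inE.
  suff : (a, b) \in (F `*` U)%fset by [].
  by rewrite in_fsetM; apply/andP.
have [P PV Pcard] := perm_on_fset V.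
have P0 : 0 < #|` P|%:R :> R.
  by rewrite ltr0n lt0n cardfs_eq0; apply/fset0Pn; exists 1%g; rewrite PV perm_on1.
have := hT (shuffler_lift V f) _;
  rewrite (mass_shuffler_lift p0 PV)// (energy_shuffler_lift p0 PV)//; last first.
  move=> t h tT fh; apply/perm_onP => z tz.
  have mz : moved t (h^-1 * z)%g.
    move=> e; apply: tz; rewrite -[LHS]/(h * sh_perm t (h^-1 * z))%g e mulVKg//.
  case/orP: fh => fh.
    rewrite -(mulVKg h z); apply: memV => //; apply: memU.
    by exists t => //; left.
  rewrite -(mulVKg h z) -(mulVKg (sh_pos t) (h^-1 * z)%g) mulgA.
  apply: memV => //; apply: memU.
  by exists t => //; right; exists (h^-1 * z)%g.
have Vcard : (#|` V| <= #|` F| * #|` U|)%N by rewrite -cardfsM; apply: leq_imfset_card.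
have admf : admissible x (shuffler_lift V f).
  have [l0 l1 l2 l3] := admissible_shuffler_lift PV fy; split=> //.
  apply: (le_trans l3); apply: le_trans yx; rewrite mulrC ler_wpM2l//.
  have VU : #|` V|%:R <= u * y.
    apply: (@le_trans _ _ (#|` F| * #|` U|)%:R); first by rewrite ler_nat.
    rewrite natrM mulrC; apply: ler_pM => //; rewrite /u -natr1; lra.
  apply: (@le_trans _ _ (#|` V| ^ #|` V|)%N%:R); first by rewrite ler_nat.
  rewrite natrX -powR_mulrn//; apply: (@le_trans _ _ ((u * y) `^ #|` V|%:R)).
    by apply: ge0_ler_powR; rewrite ?nnegrE//; lra.
  exact: ler_powR.
move=> /(_ admf); rewrite mulrCA ler_pM2l// => le1; apply: (le_trans le1).
rewrite powRM ?powR_ge0// powR_invK//; last lra.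
rewrite (mulrC (1 + C)) -mulrA; apply: ler_wpM2l; first exact: powR_ge0.
apply: (le_trans (CP f finf)); apply: ler_wpM2r; first exact: energy_ge0.
lra.
Qed.

(** * Asymptotics *)

Section Infinity.
Context {R : realType}.
Implicit Types (phi : R -> R) (P : R -> Prop).

Lemma near_pinfty_comp phi P : (forall M, \forall x \near +oo, M < phi x) ->
  (\forall x \near +oo, P x) -> \forall x \near +oo, P (phi x).
Proof.
move=> phioo [M [_ MP]]; apply: filterS (phioo M) => x; exact: MP.
Qed.

Lemma near_ln M : \forall x \near +oo, M < ln x :> R.
Proof.
apply: filterS (nbhs_pinfty_gt (num_real (expR M))) => x Mx.
by rewrite -[M]expRK ltr_ln ?posrE ?expR_gt0// (lt_trans _ Mx)// expR_gt0.
Qed.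

Lemma near_scale c M : 0 < c -> \forall x \near +oo, M < c * x :> R.
Proof.
move=> c0; apply: filterS (nbhs_pinfty_gt (num_real (M / c))) => x.
by rewrite ltr_pdivrMr// mulrC.
Qed.

Lemma near_div_ln M : \forall x \near +oo, M < x / ln x :> R.
Proof.
have := near_ln (4 * `|M| + 1);
  apply: filterS2 (nbhs_pinfty_gt (num_real 0)) => x x0 tM.
have M0 : M <= `|M| := ler_norm M.
have M1 : 0 <= `|M| by [].
have t0 : 0 < ln x by lra.
rewrite ltr_pdivlMr//.
(* With t = ln x this gives x >= (1 + t / 2)^2, so x / t exceeds t / 4. *)
have xE : x = expR (ln x / 2) * expR (ln x / 2).
  by rewrite -expRD -splitr lnK.
have := expR_ge1Dx (ln x / 2); rewrite {4}xE.
set t := ln x in tM t0 *; set e := expR _ => et.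
nra.
Qed.

(** Take logarithms, with L = ln x: u y ln (u y) <= u y ln L = L / 2 and ln y <= y <= L / 2. *)
Lemma powR_self_le (u y x : R) : 1 <= u -> 1 < ln (ln x) -> 1 < ln x -> 0 < x ->
  y = (2 * u)^-1 * (ln x / ln (ln x)) -> 1 <= y ->
  y * (u * y) `^ (u * y) <= x.
Proof.
move=> u1; set L := ln x; set l := ln L => l1 L1 x0 yE y1.
have l0 : l != 0 by rewrite gt_eqF//; lra.
have u0 : u != 0 by rewrite gt_eqF//; lra.
have uy0 : 0 < u * y by nra.
have uyl : u * y * l = L / 2.
  by rewrite yE; field; rewrite l0 u0.
have uyL : u * y <= L by nra.
have y0 : 0 < y by lra.
have lnuy : ln (u * y) <= l by rewrite /l ler_ln ?posrE//; lra.
have lny : ln y <= y - 1 by rewrite -[in ln y](subrKC 1 y) le_ln1Dx//; lra.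
rewrite -ler_ln ?posrE ?mulr_gt0 ?powR_gt0// lnM ?posrE ?powR_gt0// ln_powR -/L.
have yL : y <= L / 2 by nra.
have : u * y * ln (u * y) <= u * y * l by rewrite ler_wpM2l// ltW.
lra.
Qed.

(** [assumption_star] absorbs both c and the scale C of [asymp_le], so the final comparison holds at
    scale 1. *)
Lemma asymp_le_comp_ln (jT j1 jp : R -> \bar R) (K c : R) : 0 < K -> 0 < c ->
  (forall x, 1 <= x -> (0 <= jT x)%E) -> (forall x, 1 <= x -> (0 <= j1 x)%E) ->
  (forall x, 1 <= x -> (0 <= jp x)%E) ->
  (forall x, 2 <= x -> (jT x <= K%:E * j1 (c * ln x)%R)%E) ->
  assumption_star jp -> asymp_le j1 jp -> asymp_le jT (fun x => jp (ln x)).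
Proof.
move=> K0 c0 jT0 j10 jp0 upper star [C C0 [K1 K10 j1p]].
have [K2 K20 starC] := star (C * c) (mulr_gt0 C0 c0).
exists 1 => //; exists (K * (K1 * K2)); first by rewrite !mulr_gt0.
have lnc (M : R) : \forall x \near +oo, M < c * ln x.
  exact: (near_pinfty_comp near_ln (near_scale M c0)).
near=> x; rewrite mul1r.
have L1 : 1 < ln x by near: x; apply: near_ln.
have cL1 : 1 < c * ln x by near: x; apply: lnc.
have x2 : 2 < x by near: x; apply: nbhs_pinfty_gt.
have x1 : 1 < x by lra.
have C1 : 1 < C * (c * ln x).
  by near: x; exact: (near_pinfty_comp lnc (near_scale 1 C0)).
have A1 : (`|j1 (c * ln x)%R| <= K1%:E * `|jp (C * (c * ln x))%R|)%E.
  by near: x; exact: (near_pinfty_comp lnc j1p).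
have A2 : (`|jp (C * c * ln x)%R| <= K2%:E * `|jp (ln x)|)%E.
  by near: x; exact: (near_pinfty_comp near_ln starC).
have cE : C * c * ln x = C * (c * ln x) by rewrite mulrA.
have nT := jT0 x (ltW x1); have n1 := j10 _ (ltW cL1).
have nC := jp0 _ (ltW C1); have nL := jp0 _ (ltW L1).
rewrite cE (gee0_abs nC) (gee0_abs nL) in A2.
rewrite (gee0_abs n1) (gee0_abs nC) in A1.
rewrite (gee0_abs nT) (gee0_abs nL); apply: (le_trans (upper x (ltW x2))).
rewrite EFinM -muleA lee_pmul2l// EFinM -muleA; apply: (le_trans A1).
by rewrite lee_pmul2l.
Unshelve. all: by end_near.
Qed.

(** With L = ln x and y = L / (2 u ln L), up to constant factors jp(L) <= jp(C L / ln (C L)) <= jp(4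
    u C y) <= jp(y) <= jT(x). The four steps use the comparison with x / ln x, monotonicity,
    [assumption_star] and the lower bound. *)
Lemma asymp_ge_comp_ln (jT jp : R -> \bar R) (K u : R) : 0 < K -> 1 <= u ->
  (forall x, 1 <= x -> (0 <= jT x)%E) -> (forall x, 1 <= x -> (0 <= jp x)%E) ->
  {homo jp : x y / x <= y >-> (x <= y)%E} ->
  (forall y x, 1 <= y -> y * (u * y) `^ (u * y) <= x -> (jp y <= K%:E * jT x)%E) ->
  assumption_star jp -> asymp_le jp (fun x => jp (x / ln x)) ->
  asymp_le (fun x => jp (ln x)) jT.
Proof.
move=> K0 u1 jT0 jp0 mono lower star [C C0 [K1 K10 divln]].
have e0 : 0 < (2 * u)^-1 by rewrite invr_gt0; lra.
have C40 : 0 < 4 * u * C by rewrite !mulr_gt0//; lra.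
have [K2 K20 starC] := star _ C40.
exists 1 => //; exists (K1 * (K2 * K)); first by rewrite !mulr_gt0.
have divL (M : R) : \forall x \near +oo, M < ln x / ln (ln x).
  exact: (near_pinfty_comp (P := fun z => M < z / ln z) near_ln (near_div_ln M)).
have edivL (M : R) : \forall x \near +oo, M < (2 * u)^-1 * (ln x / ln (ln x)).
  exact: (near_pinfty_comp divL (near_scale M e0)).
have lnC (M : R) : \forall x \near +oo, M < C * ln x.
  exact: (near_pinfty_comp near_ln (near_scale M C0)).
have lnln (M : R) : \forall x \near +oo, M < ln (ln x).
  exact: (near_pinfty_comp (P := fun z => M < ln z) near_ln (near_ln M)).
near=> x; rewrite mul1r.
have x1 : 1 < x by near: x; apply: nbhs_pinfty_gt.
have L1 : 1 < ln x by near: x; apply: near_ln.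
have l1 : 1 < ln (ln x) by near: x; apply: lnln.
(* Ensures ln (C L) >= ln L / 2 even when C < 1, at the price of a factor 2 in 4 u C. *)
have lC : - 2 * ln C < ln (ln x) by near: x; apply: lnln.
have y1 : 1 < (2 * u)^-1 * (ln x / ln (ln x)) by near: x; apply: edivL.
have D1 : 1 < C * ln x / ln (C * ln x).
  by near: x; exact: (near_pinfty_comp (P := fun z => 1 < z / ln z) lnC (near_div_ln 1)).
have A1 : (`|jp (ln x)| <= K1%:E * `|jp (C * ln x / ln (C * ln x))%R|)%E.
  by near: x; exact: (near_pinfty_comp near_ln divln).
have A2 : (`|jp (4 * u * C * ((2 * u)^-1 * (ln x / ln (ln x))))%R| <=
    K2%:E * `|jp ((2 * u)^-1 * (ln x / ln (ln x)))%R|)%E.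
  by near: x; exact: (near_pinfty_comp edivL starC).
move: L1 l1 lC y1 D1 A1 A2; set L := ln x; set y := _^-1 * _.
move=> L1 l1 lC y1 D1 A1 A2.
have Dy : C * L / ln (C * L) <= 4 * u * C * y.
  have -> : 4 * u * C * y = C * L / (ln L / 2).
    by rewrite /y; field; rewrite !gt_eqF//; lra.
  have lnCL : ln (C * L) = ln C + ln L by rewrite lnM ?posrE//; lra.
  rewrite ler_wpM2l//; first by rewrite mulr_ge0; lra.
  rewrite lef_pV2 ?posrE ?lnCL; lra.
have x0 : 0 < x by lra.
have A3 := lower y x (ltW y1) (powR_self_le u1 l1 L1 x0 erefl (ltW y1)).
have nT := jT0 x (ltW x1); have nL := jp0 _ (ltW L1).
have nD := jp0 _ (ltW D1); have nE := jp0 _ (le_trans (ltW D1) Dy).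
have ny := jp0 _ (ltW y1).
rewrite (gee0_abs nE) (gee0_abs ny) in A2.
rewrite (gee0_abs nL) (gee0_abs nD) in A1.
rewrite (gee0_abs nT) (gee0_abs nL); apply: (le_trans A1).
rewrite EFinM -muleA lee_pmul2l//; apply: (le_trans (mono _ _ Dy)).
apply: (le_trans A2); rewrite EFinM -muleA lee_pmul2l//.
Unshelve. all: by end_near.
Qed.

End Infinity.

Theorem corollaryB (R : realType) (p : R) (H : groupType)
    (S : {fset H}) (T : {fset shuffler H}) :
  1 <= p ->
  generates S ->
  generates T ->
  amenable R H ->
  assumption_star (profile p S) ->
  asymp_eq (fun x : R => profile p S (x / ln x)) (profile p S) ->
  asymp_eq (profile p S) (profile 1 S) ->
  asymp_eq (profile p T) (fun x : R => profile p S (ln x)).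
Proof.
move=> p1 genS genT _ star [_ divln] [_ j1p]; split.
- have [K [c [K0 c0 upper]]] := profile_shuffler_le S p1 genT.
  apply: (asymp_le_comp_ln K0 c0 _ _ _ upper star j1p) => x x1; exact: profile_ge0.
- have [K [u [K0 u1 lower]]] := profile_shuffler_ge T p1 genS.
  apply: (asymp_ge_comp_ln K0 u1 _ _ _ lower star divln).
  + by move=> x x1; apply: profile_ge0.
  + by move=> x x1; apply: profile_ge0.
  + by move=> x y xy; apply: profile_mono.
Qed.
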